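(* Let $k\in\mathbb{N}$, $W=(w_1,\dots,w_k)\in\mathbb{R}^k$, and let $A_N$ be drawn from the $N\times N$ $(k,W)$-checkerboard ensemble, independently for each $N$. Suppose that exactly $x$ of the entries of $W$ are nonzero, and let $w'_1,\dots,w'_s$ be the distinct nonzero values occurring among $w_1,\dots,w_k$, with $w'_i$ occurring exactly $k_i$ times (so $k_1+\dots+k_s=x$). Then for every $\epsilon>0$, almost surely, as $N\to\infty$ the eigenvalues of $A_N$ split into $s+1$ regimes: $N-x$ of the eigenvalues are $O(N^{1/2+\epsilon})$, and for each $i\in\{1,\dots,s\}$ exactly $k_i$ eigenvalues are of the form $Nw'_i/k+O(N^{1/2+\epsilon})$.
   Context: Fix $k\in\mathbb N$ and $W=(w_1,\dots,w_k)\in\mathbb R^k$. The $N\times N$ $(k,W)$-checkerboard ensemble consists of real symmetric matrices $M=(m_{ij})$ with $m_{ij}=w_u$ if $i\equiv j\equiv u \pmod k$ (where $u\in\{1,\dots,k\}$) and $m_{ij}=a_{ij}$ if $i\not\equiv j\pmod k$, where the $a_{ij}=a_{ji}$ ($i<j$) are i.i.d. real random variables with mean $0$, variance $1$ and finite moments of all orders, with the natural product probability measure. *)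

(* Defs.v *)
From HB Require Import structures.
From mathcomp Require Import all_boot all_order all_algebra.
From mathcomp Require Import all_classical all_reals all_analysis.
Set Implicit Arguments. Unset Strict Implicit. Unset Printing Implicit Defensive.
Import Order.TTheory GRing.Theory Num.Theory.
Local Open Scope classical_set_scope.
Local Open Scope ring_scope.

Definition mutually_independent (d : measure_display) (T : measurableType d)
  (R : realType) (P : probability T R) (I : eqType) (D : set I)
  (X : I -> T -> R) : Prop :=
  forall (J : seq I) (B : I -> set R),
    uniq J -> (forall i, i \in J -> D i) ->
    (forall i, i \in J -> measurable (B i)) ->
    P (\bigcap_(i in [set` J]) (X i @^-1` B i)) =
    (\prod_(i <- J) P (X i @^-1` B i))%E.

Definition same_distribution (d : measure_display) (T : measurableType d)
  (R : realType) (P : probability T R) (X Y : T -> R) : Prop :=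
  forall B : set R, measurable B -> P (X @^-1` B) = P (Y @^-1` B).

(* The N x N (k,W)-checkerboard matrix built from the entries a i j (i < j),
   indices 0-based: row/column i corresponds to the paper's i+1, and the
   residue class u in {1..k} corresponds to the 0-based entry (u-1) of W. *)
Definition checkerboard (R : realType) (k : nat) (W : seq R) (N : nat)
  (a : nat -> nat -> R) : 'M[R]_N :=
  \matrix_(i < N, j < N)
    if (i %% k == j %% k)%N then nth 0 W (i %% k)
    else a (minn i j) (maxn i j).

Definition eigenvalue_list (R : realType) (N : nat) (A : 'M[R]_N) (s : seq R) : Prop :=
  size s = N /\ char_poly A = \prod_(x <- s) ('X - x%:P).

(* Main.v *)
Require Import Defs.
From HB Require Import structures.
From mathcomp Require Import all_boot all_order all_algebra.
From mathcomp Require Import all_classical all_reals all_analysis.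
From mathcomp Require Import complex spectral measurable_realfun.
From mathcomp Require Import ring lra zify.
Set Implicit Arguments. Unset Strict Implicit. Unset Printing Implicit Defensive.
Import Order.TTheory GRing.Theory Num.Theory.
Local Open Scope ring_scope.

(** Write the checkerboard matrix as [A = B + M], where [B] carries the weights
    and [M] the random entries. [B] has rank at most [k] and its characteristic
    polynomial is computed exactly by Sylvester's determinant identity: the
    nonzero eigenvalues are [w_u] times the size of the residue class [u], which
    is [N/k + O(1)]. By Weyl's inequality the ordered eigenvalues of [A] and [B]
    differ by at most the spectral norm of [M], so they inherit the labels of
    those of [B].

    For the norm of [M] use the moment method: the norm to the power [2m] is at
    most [tr M^(2m)], a sum over closed walks of length [2m]. By independence a
    walk crossing some edge exactly once has mean zero, and the other walks
    visit at most [m + 1] vertices, so that [E tr M^(2m) = O(N^(m+1))]. Hence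
    [tr M^(2m) / N^(m+3)] has a summable sequence of means and is almost surely
    bounded, which gives a norm [O(N^(1/2 + 3/(2m)))]; take [m] with
    [3 <= m eps]. *)

(** * Spectral theory of real symmetric matrices *)

Section SpectralTheory.
Local Open Scope sesquilinear_scope.

(** The unitary is complex, while the eigenvalues are kept real so that they can be ordered. The
    rows of [U] are the eigenvectors. *)
Definition spectral_pair (R : rcfType) (n : nat) (A : 'M[R]_n)
    (U : 'M[R[i]]_n) (d : 'rV[R]_n) : Prop :=
  U \is unitarymx /\ map_mx (real_complex R) A =
    U ^t* *m diag_mx (map_mx (real_complex R) d) *m U.

Lemma symmetric_spectral (R : rcfType) (n : nat) (A : 'M[R]_n) :
  A^T = A -> exists U d, spectral_pair A U d.
Proof.
move=> Asym; set B := map_mx (real_complex R) A.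
have Breal : B \is a realmx.
  by apply/mxOverP => i j; rewrite mxE; apply/complex_realP; exists (A i j).
have Bherm : B \is hermsymmx.
  apply: realsym_hermsym Breal; apply/is_hermitianmxP.
  by apply/matrixP => i j; rewrite expr0 scale1r !mxE -[in LHS]Asym mxE.
have sreal := hermitian_spectral_diag_real Bherm.
have /hermitian_normalmx /orthomx_spectralP BE := Bherm.
exists (spectralmx B), (map_mx (@complex.Re R) (spectral_diag B)); split.
  exact: spectral_unitarymx.
have -> : map_mx (real_complex R) (map_mx (@complex.Re R) (spectral_diag B)) =
    spectral_diag B.
  by apply/rowP => j; rewrite !mxE RRe_real //; apply: (mxOverP sreal).
by rewrite -(invmx_unitary (spectral_unitarymx B)).
Qed.

(** Eliminating the lower left block of [M], by a triangular factor on the right or on the left,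
    evaluates [\det M] in two ways. *)
Lemma char_poly_mulmxC (F : idomainType) (n k : nat) (A : 'M[F]_(n, k))
    (B : 'M[F]_(k, n)) :
  'X^k * char_poly (A *m B) = 'X^n * char_poly (B *m A).
Proof.
pose Ap := map_mx polyC A; pose Bp := map_mx polyC B.
pose M := block_mx ('X%:M : 'M[{poly F}]_n) Ap Bp (1%:M : 'M[{poly F}]_k).
have detAB : \det M = char_poly (A *m B).
  have := det_mulmx M (block_mx 1%:M 0 (- Bp) 1%:M).
  rewrite det_lblock !det1 !mulr1 => <-.
  rewrite mulmx_block !mulmx1 !mulmx0 !mul1mx subrr !add0r.
  by rewrite det_ublock det1 mulr1 mulmxN /char_poly /char_poly_mx map_mxM.
have detBA : 'X^k * \det M = 'X^n * char_poly (B *m A).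
  have := det_mulmx (block_mx (1%:M : 'M[{poly F}]_n) 0 (- Bp) ('X%:M : 'M[{poly F}]_k)) M.
  rewrite det_lblock det1 mul1r det_scalar => <-.
  rewrite mulmx_block !mulmx1 !mul1mx !mul0mx !addr0.
  rewrite mulNmx mul_mx_scalar mul_scalar_mx addNr.
  by rewrite det_ublock det_scalar mulNmx addrC /char_poly /char_poly_mx map_mxM.
by rewrite -detAB detBA.
Qed.

Lemma char_poly_conj (F : idomainType) (n : nat) (U V D : 'M[F]_n) :
  U *m V = 1%:M -> char_poly (V *m D *m U) = char_poly D.
Proof.
move=> UV; have Xn0 : 'X^n != 0 :> {poly F} by rewrite monic_neq0 ?monicXn.
by apply: (mulfI Xn0); rewrite -mulmxA char_poly_mulmxC -mulmxA UV mulmx1.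
Qed.

Lemma exp_conjmx (F : comUnitRingType) (n m : nat) (U V D : 'M[F]_n) :
  U *m V = 1%:M -> (V *m D *m U) ^+ m = V *m D ^+ m *m U.
Proof.
move=> UV; elim: m => [|m IHm].
  by rewrite !expr0 mulmx1; apply/esym/mulmx1C.
rewrite !exprS -[_ * _]/(_ *m _) IHm.
by rewrite -!mulmxA (mulmxA U) UV mul1mx !mulmxA.
Qed.

Lemma exp_diag_mx (F : comNzRingType) (n m : nat) (d : 'rV[F]_n) :
  diag_mx d ^+ m = diag_mx (\row_j (d 0 j ^+ m)).
Proof.
elim: m => [|m IHm]; first by apply/matrixP => i j; rewrite !mxE !expr0.
rewrite exprS -[_ * _]/(_ *m _) IHm mulmx_diag; congr diag_mx.
by apply/rowP => j; rewrite !mxE exprS.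
Qed.

Lemma sumr_gt0_at (F : numDomainType) (I : finType) (f : I -> F) (i : I) :
  (forall j, 0 <= f j) -> 0 < f i -> 0 < \sum_j f j.
Proof.
move=> f0 fi; rewrite (bigD1 i) //=.
by apply: ltr_wpDr => //; apply: sumr_ge0.
Qed.

Section Spectral.
Variables (R : rcfType) (n : nat).
Implicit Types (A B : 'M[R]_n) (U : 'M[R[i]]_n) (d : 'rV[R]_n).
Local Notation toC := (map_mx (real_complex R)).

Lemma spectral_pair_char_poly A U d : spectral_pair A U d ->
  char_poly A = \prod_(i < n) ('X - (d 0 i)%:P).
Proof.
move=> [Uu AE]; apply: (@map_poly_inj _ _ (real_complex R)).
rewrite map_char_poly AE (char_poly_conj _ (unitarymxP Uu)).
rewrite char_poly_trig ?diag_mx_is_trig // rmorph_prod /=.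
by apply: eq_bigr => i _; rewrite map_polyXsubC !mxE eqxx mulr1n.
Qed.

Lemma spectral_pair_exp_trace A U d m : spectral_pair A U d ->
  \tr (A ^+ m) = \sum_(i < n) d 0 i ^+ m.
Proof.
move=> [Uu AE]; apply: (@complexI R).
have UU := unitarymxP Uu.
have toCX (B : 'M[R]_n) : toC (B ^+ m) = toC B ^+ m.
  elim: m => [|p IHp]; first by rewrite !expr0 map_mx1.
  by rewrite !exprS -[_ * _]/(_ *m _) map_mxM IHp.
rewrite -trace_map_mx toCX AE (exp_conjmx _ _ UU) mxtrace_mulC mulmxA UU mul1mx.
rewrite exp_diag_mx mxtrace_diag rmorph_sum; apply: eq_bigr => i _.
by rewrite !mxE rmorphXn.
Qed.

Lemma spectral_pair_quadratic A U d (v : 'rV[R[i]]_n) : spectral_pair A U d ->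
  (v *m toC A *m v ^t*) 0 0 =
  \sum_(i < n) (d 0 i)%:C%C * `|(v *m U ^t*) 0 i| ^+ 2.
Proof.
move=> [Uu ->]; set y := v *m U ^t*.
have -> : v *m (U ^t* *m diag_mx (toC d) *m U) *m v ^t* = y *m diag_mx (toC d) *m y ^t*.
  by rewrite /y trmx_mul map_mxM trmxCK !mulmxA.
rewrite mxE; apply: eq_bigr => i _.
by rewrite mul_mx_diag !mxE normCK mulrAC mulrC mulrA.
Qed.

Lemma unitary_dot U (v : 'rV[R[i]]_n) : U \is unitarymx ->
  (v *m v ^t*) 0 0 = \sum_(i < n) `|(v *m U ^t*) 0 i| ^+ 2.
Proof.
move=> Uu; set y := v *m U ^t*.
have -> : v *m v ^t* = y *m y ^t*.
  rewrite /y trmx_mul map_mxM trmxCK mulmxA -(mulmxA v) -(invmx_unitary Uu).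
  by rewrite mulVmx ?unitarymx_unit // mulmx1.
by rewrite mxE; apply: eq_bigr => i _; rewrite !mxE normCK.
Qed.

(** Each prescribed orthogonality is one linear condition on [v]; fewer than [n] conditions, the
    columns of [G], leave a nonzero left kernel. *)
Lemma exists_orthogonal_vector (U V : 'M[R[i]]_n) (I J : {set 'I_n}) :
  (#|I| + #|J| < n)%N ->
  exists2 v : 'rV[R[i]]_n, v != 0 &
    (forall i, i \in I -> (v *m U ^t*) 0 i = 0) /\
    (forall i, i \in J -> (v *m V ^t*) 0 i = 0).
Proof.
move=> ltIJ.
pose G := row_mx (colsub (fun i : 'I_#|I| => enum_val i) (U ^t*))
                 (colsub (fun i : 'I_#|J| => enum_val i) (V ^t*)).
have kerG : kermx G != 0.
  rewrite -mxrank_eq0 mxrank_ker subn_eq0 -ltnNge.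
  exact: leq_ltn_trans (rank_leq_col G) ltIJ.
have /rowV0Pn [v vG vn0] := kerG; exists v => //.
move/sub_kermxP: vG; rewrite mul_mx_row => vG.
have vz (W : 'M[R[i]]_n) (K : {set 'I_n}) :
    v *m colsub (fun i : 'I_#|K| => enum_val i) W = 0 ->
    forall i, i \in K -> (v *m W) 0 i = 0.
  move=> vW i iK.
  have /matrixP/(_ 0 (enum_rank_in iK i)) := vW.
  rewrite [RHS]mxE => vW0; rewrite -[RHS]vW0 !mxE; apply: eq_bigr => j _.
  by rewrite !mxE enum_rankK_in.
by move: vG; rewrite -[0]row_mx0 => /eq_row_mx [vI vJ]; split; exact: vz.
Qed.

(* On a vector orthogonal to the eigenvectors of [A] with eigenvalue at most
   [t + e] and to those of [B] with eigenvalue above [t], the forms of [A] and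
   [B] differ too much for [A - B]. *)
Lemma weyl_count A B U V W a b c (e t : R) :
  spectral_pair A U a -> spectral_pair B V b -> spectral_pair (A - B) W c ->
  (forall i, c 0 i <= e) ->
  (#|[set i | (t + e < a 0 i)%R]| <= #|[set i | (t < b 0 i)%R]|)%N.
Proof.
move=> UA VB WC ce; rewrite leqNgt; apply/negP => lt_ab.
pose I := [set i | a 0 i <= t + e]; pose J := [set i | t < b 0 i].
have IC : I = ~: [set i | t + e < a 0 i].
  by apply/setP => i; rewrite !inE leNgt.
have ltIJ : (#|I| + #|J| < n)%N.
  rewrite -[n in (_ < n)%N]card_ord -(cardsC [set i | t + e < a 0 i]) -IC addnC.
  by rewrite ltn_add2r.
have [v vn0 [vI vJ]] := exists_orthogonal_vector U V ltIJ.
pose q := (v *m v ^t*) 0 0.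
have Auni := unitary_dot v (proj1 UA).
have q_gt0 : 0 < q.
  move/rV0Pn: vn0 => [i vi]; rewrite /q mxE.
  apply: (sumr_gt0_at (i := i)) => [j|]; rewrite !mxE -normCK.
    by rewrite exprn_ge0.
  by rewrite exprn_gt0 // normr_gt0.
(* Strict, because some nonzero coordinate of [v] lies outside [I], where the eigenvalue of [A]
   exceeds [t + e]. *)
have qA : (t + e)%:C%C * q < (v *m toC A *m v ^t*) 0 0.
  rewrite (spectral_pair_quadratic v UA) /q Auni mulr_sumr.
  have /existsP [i yi] : [exists i, (v *m U ^t*) 0 i != 0].
    apply: contraLR q_gt0; rewrite negb_exists => /forallP y0.
    rewrite /q Auni big1 ?ltxx // => i _.
    by have := y0 i; rewrite negbK => /eqP ->; rewrite normr0 expr0n.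
  rewrite -subr_gt0 -sumrB; apply: (sumr_gt0_at (i := i)) => [j|].
    have [jI|jI] := boolP (j \in I).
      by rewrite vI // normr0 expr0n /= !mulr0 subrr.
    rewrite -mulrBl mulr_ge0 ?exprn_ge0 // subr_ge0 lecR.
    by move: jI; rewrite inE -ltNge => /ltW.
  rewrite -mulrBl mulr_gt0 ?exprn_gt0 ?normr_gt0 // subr_gt0 ltcR ltNge.
  by apply: contra yi => ai; rewrite vI // inE.
have qB : (v *m toC B *m v ^t*) 0 0 <= t%:C%C * q.
  rewrite (spectral_pair_quadratic v VB) /q (unitary_dot v (proj1 VB)) mulr_sumr.
  apply: ler_sum => i _; have [iJ|iJ] := boolP (i \in J).
    by rewrite vJ // normr0 expr0n /= !mulr0.
  rewrite ler_wpM2r ?exprn_ge0 // lecR.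
  by move: iJ; rewrite inE -leNgt.
have qC : (v *m toC (A - B) *m v ^t*) 0 0 <= e%:C%C * q.
  rewrite (spectral_pair_quadratic v WC) /q (unitary_dot v (proj1 WC)) mulr_sumr.
  by apply: ler_sum => i _; rewrite ler_wpM2r ?exprn_ge0 // lecR.
have := lt_le_trans qA (_ : _ <= (t + e)%:C%C * q).
rewrite ltxx => H; suff: false by []; apply: H.
have -> : A = B + (A - B) by rewrite addrC subrK.
have -> : (v *m toC (B + (A - B)) *m v ^t*) 0 0 =
    (v *m toC B *m v ^t*) 0 0 + (v *m toC (A - B) *m v ^t*) 0 0.
  by rewrite map_mxD mulmxDr mulmxDl mxE.
have -> : (t + e)%:C%C * q = t%:C%C * q + e%:C%C * q by rewrite -mulrDl -rmorphD.
exact: lerD.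
Qed.

End Spectral.

End SpectralTheory.

(** * Sorted lists and counting functions *)

(** Turns order statistics into counts of large eigenvalues, the form in which Weyl's inequality is
    available. *)
Lemma sorted_lt_count (R : realDomainType) (s : seq R) (i : nat) (t : R) :
  sorted <=%R s -> (i < size s)%N ->
  (t < nth 0 s i) = (size s - i <= count (fun x => (t < x)%R) s)%N.
Proof.
Proof.
move=> ss si; pose p x := (t < x)%R; rewrite -/p.
have sdrop : size (drop i s) = (size s - i)%N by rewrite size_drop.
have le_nth := sorted_leq_nth le_trans le_refl 0 ss.
have [lt_t|le_t] := ltP t (nth 0 s i).
  suff : all p (drop i s).
    rewrite all_count => /eqP cd.
    by rewrite -[in count _ _](cat_take_drop i s) count_cat cd sdrop leq_addl.
  apply/(all_nthP 0) => j; rewrite sdrop nth_drop => ji.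
  apply: lt_le_trans lt_t _; apply: le_nth; rewrite ?inE ?leq_addr //.
  by rewrite -ltn_subRL.
(* If entry [i] is at most [t], so are all [i + 1] entries up to it, and too few others remain. *)
suff cs : count p (take i.+1 s) == 0%N.
  apply/esym/negbTE; rewrite -ltnNge -[in count _ _](cat_take_drop i.+1 s).
  rewrite count_cat (eqP cs) add0n; apply: leq_ltn_trans (count_size _ _) _.
  by rewrite size_drop subnSK.
rewrite -leqn0 leqNgt -has_count; apply/negP => /(has_nthP 0) [j].
rewrite size_takel // => ji; rewrite nth_take // => tj.
have : nth 0 s j <= nth 0 s i by apply: le_nth; rewrite ?inE //; exact: leq_trans ji si.
by move=> /(lt_le_trans tj); rewrite ltNge le_t.
Qed.

(** If entry [i] of [s] exceeded entry [i] of [u] by more than [e], taking the latter for [t] would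
    make at least [size u - i] entries of [u] exceed it, which sortedness forbids. The other side is
    symmetric. *)
Lemma sorted_close (R : realDomainType) (s u : seq R) (e : R) :
  size s = size u -> sorted <=%R s -> sorted <=%R u ->
  (forall t, (count (fun x => (t + e < x)%R) s <= count (fun x => (t < x)%R) u)%N) ->
  (forall t, (count (fun x => (t + e < x)%R) u <= count (fun x => (t < x)%R) s)%N) ->
  forall i, (i < size s)%N -> `|nth 0 s i - nth 0 u i| <= e.
Proof.
move=> su ss us csu cus i si.
have ui : (i < size u)%N by rewrite -su.
have half (p r : seq R) : size p = size r -> sorted <=%R p -> sorted <=%R r ->
    (forall t, (count (fun x => (t + e < x)%R) p <= count (fun x => (t < x)%R) r)%N) ->
    (i < size p)%N -> nth 0 p i <= nth 0 r i + e.
  move=> pr sp sr cpr ip; rewrite leNgt; apply/negP.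
  rewrite sorted_lt_count // => /leq_trans /(_ (cpr _)).
  by rewrite pr -sorted_lt_count -?pr // ltxx.
rewrite ler_distlC lerBlDr; apply/andP; split; first exact: half.
exact: half.
Qed.
(** * Counting walks *)

Fixpoint words (T : Type) (l : nat) (s : seq T) : seq (seq T) :=
  if l is l'.+1 then [seq x :: p | x <- s, p <- words l' s] else [:: [::]].

Lemma mem_words (T : eqType) (l : nat) (s p : seq T) :
  (p \in words l s) = (size p == l) && all (mem s) p.
Proof.
elim: l p => [|l IHl] [|x p] //=.
  by apply/negbTE/allpairsPdep => -[y [q [_ _]]].
apply/allpairsPdep/idP => [[y [q [ys qw [-> ->]]]]|/and3P [sp xs ps]].
  by move: qw; rewrite IHl eqSS => /andP [-> ->]; rewrite ys.
by exists x, p; split => //; rewrite IHl -eqSS sp.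
Qed.

Lemma words_uniq (T : eqType) (l : nat) (s : seq T) : uniq s -> uniq (words l s).
Proof.
move=> us; elim: l => [|l IHl] //=; apply: allpairs_uniq => //.
by move=> [x p] [y q] _ _ /= [-> ->].
Qed.

Lemma size_words (T : Type) (l : nat) (s : seq T) : size (words l s) = (size s ^ l)%N.
Proof. by elim: l => [|l IHl] //=; rewrite size_allpairs IHl expnS. Qed.

(* A word with at most [r] letters is an [r]-tuple of letters together with a
   word over the positions of that tuple. *)
Lemma count_words_few_letters (T : eqType) (l r : nat) (s : seq T) : (0 < l)%N -> uniq s ->
  (count (fun q => size (undup q) <= r) (words l s) <= size s ^ r * r ^ l)%N.
Proof.
case: s => [|x0 s'] l0 us; first by case: l l0.
set s := x0 :: s' in us *.
rewrite -(size_words r s) -[r in (r ^ l)%N](size_iota 0) -size_words -size_filter.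
rewrite -(size_allpairs (fun g h => [seq nth x0 g i | i <- h])).
apply: uniq_leq_size; first by rewrite filter_uniq // words_uniq.
move=> q; rewrite mem_filter mem_words => /and3P [uq /eqP sq qs].
(* The distinct letters of [q], padded with [x0] to length exactly [r]. *)
pose g := undup q ++ nseq (r - size (undup q)) x0.
apply/allpairsP; exists (g, [seq index x g | x <- q]); rewrite !mem_words /=; split.
- rewrite size_cat size_nseq subnKC // eqxx /= all_cat all_nseq /= inE eqxx orbT andbT.
  by apply/allP => x; rewrite mem_undup => /(allP qs).
- rewrite size_map sq eqxx /=; apply/allP => _ /mapP [x xq ->].
  rewrite inE mem_iota add0n /= -[r in (_ < r)%N](subnKC uq).
  rewrite -[(r - _)%N](size_nseq _ x0) -size_cat index_mem mem_cat.
  by rewrite mem_undup xq.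
- rewrite -map_comp -[LHS]map_id; apply/eq_in_map => x xq /=.
  by rewrite nth_index // mem_cat mem_undup xq.
Qed.

Section Walks.
Variable n : nat.
Implicit Types (i j : 'I_n) (p : seq 'I_n).

(** Edges are undirected: with the smaller endpoint first, both directions give the same pair, the
    index of the random entry they share. *)
Fixpoint walk_edges i p : seq (nat * nat) :=
  if p is j :: p' then (minn i j, maxn i j) :: walk_edges j p' else [::].

Lemma size_walk_edges i p : size (walk_edges i p) = size p.
Proof. by elim: p i => //= j p IHp i; rewrite IHp. Qed.

Lemma walk_edges_vertex i j p e :
  e \in walk_edges i p -> (e.1 == j) || (e.2 == j) -> j \in i :: p.
Proof.
elim: p i => //= x p IHp i; rewrite inE => /orP [/eqP -> /=|ep ej]; last first.
  by rewrite inE IHp ?orbT.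
rewrite !inE -!val_eqE /=; case: leqP => _ /orP [] /eqP ->; rewrite eqxx ?orbT //.
Qed.

(* The first edge at a vertex which is not visited later is not used later. *)
Lemma size_undup_walk i p :
  (size (undup (i :: p)) <= (size (undup (walk_edges i p))).+1)%N.
Proof.
elim: p i => [|j p IHp] i //.
rewrite [walk_edges _ _]/= [undup (i :: _)]/= [undup (_ :: walk_edges _ _)]/=.
case: ifPn => ip; first by apply: leq_trans (IHp j) _; case: ifP => //= _; lia.
have eN : (minn i j, maxn i j) \notin walk_edges j p.
  apply: contra ip => /walk_edges_vertex; apply.
  by rewrite /=; case: leqP; rewrite eqxx ?orbT.
by rewrite (negbTE eN) /= ltnS; exact: (IHp j).
Qed.

(** Each distinct edge takes up at least two of the [2m] steps, so there are at most [m] of them,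
    and a walk has at most one more vertex than distinct edges. *)
Lemma size_undup_walk_double i p (m : nat) : size p = m.*2 ->
  (forall e, e \in walk_edges i p -> (1 < count_mem e (walk_edges i p))%N) ->
  (size (undup (i :: p)) <= m.+1)%N.
Proof.
move=> sp e2; apply: leq_trans (size_undup_walk i p) _; rewrite ltnS.
set E := walk_edges i p in e2 *.
rewrite -leq_double -sp -(size_walk_edges i p) -/E.
rewrite -[size E]sum1_size -big_undup_iterop_count -muln2 -sum1_size big_distrl /=.
rewrite big_seq [X in (_ <= X)%N]big_seq; apply: leq_sum => e.
rewrite mem_undup => /e2 e2'.
by rewrite mul1n Monoid.iteropE iter_addn_0 mul1n.
Qed.

Variable R : comUnitRingType.
Implicit Type M : 'M[R]_n.

Fixpoint walk_weight M i p : R :=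
  if p is j :: p' then M i j * walk_weight M j p' else 1.

Lemma expmx_walks M l i j :
  (M ^+ l) i j = \sum_(p <- words l (enum 'I_n) | last i p == j) walk_weight M i p.
Proof.
elim: l i => [|l IHl] i.
  rewrite expr0 big_mkcond /= big_seq1 mxE /=.
  by case: eqP.
rewrite exprS mxE [RHS]big_mkcond /= big_allpairs_dep /= big_enum /=.
apply: eq_bigr => x _; rewrite IHl big_mkcond mulr_sumr.
by apply: eq_bigr => p _; case: ifP; rewrite ?mulr0.
Qed.

Lemma trace_expmx_walks M l :
  \tr (M ^+ l) = \sum_(i < n) \sum_(p <- words l (enum 'I_n) | last i p == i)
                   walk_weight M i p.
Proof. by apply: eq_bigr => i _; rewrite expmx_walks. Qed.

(** A start followed by [l] steps is a word of length [l + 1]. Closedness is dropped, which only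
    enlarges the count. *)
Lemma count_closed_walks (l r : nat) :
  (\sum_(i < n) count (fun p => size (undup (i :: p)) <= r) (words l (enum 'I_n))
   <= n ^ r * r ^ l.+1)%N.
Proof.
have := count_words_few_letters r (ltn0Sn l) (enum_uniq 'I_n).
rewrite size_enum_ord; apply: leq_trans; rewrite /= count_flatten sumnE.
rewrite [X in (_ <= X)%N]big_map [X in (_ <= X)%N]big_map.
rewrite [X in (_ <= X)%N]big_enum /=; apply: leq_sum => i _.
by rewrite count_map.
Qed.
End Walks.

Local Open Scope classical_set_scope.

(** * Deterministic regimes of the checkerboard matrix *)

Definition class_size (k N u : nat) : nat := \sum_(i < N) (i %% k == u).

(** Every full period of [k] indices contributes one to the class, the incomplete period at most
    one. *)
Lemma class_size_bound (k N u : nat) : (u < k)%N ->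
  (N %/ k <= class_size k N u <= (N %/ k).+1)%N.
Proof.
move=> uk; have k0 : (0 < k)%N by case: k uk.
have small r : (r <= k)%N -> class_size k r u = (u < r)%N.
  elim: r => [|r IHr] rk; first by rewrite /class_size big_ord0.
  rewrite /class_size big_ord_recr /= -/(class_size k r u) IHr; last exact: ltnW.
  by rewrite modn_small // ltnS; case: (ltngtP r u).
have shift q r : class_size k (q * k + r) u = (q + class_size k r u)%N.
  elim: q => [|q IHq]; first by rewrite mul0n !add0n.
  rewrite mulSn -addnA /class_size big_split_ord /= -/(class_size k k u) small // uk.
  rewrite addSn -add1n; congr addn; rewrite -IHq /class_size.
  by apply: eq_bigr => i _; rewrite modnDl.
rewrite [in class_size _ _ _](divn_eq N k) shift small; last exact/ltnW/ltn_pmod.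
by case: (_ < _)%N; lia.
Qed.

Lemma class_size_close (R : realType) (k N u : nat) : (u < k)%N ->
  `|(class_size k N u)%:R - N%:R / k%:R| <= 1 :> R.
Proof.
move=> uk; have k0 : (0 < k)%N by case: k uk.
have k0R : 0 < k%:R :> R by rewrite ltr0n.
have /andP [lo hi] := class_size_bound N uk.
have lo' : (N <= class_size k N u * k + k)%N.
  rewrite {1}(divn_eq N k); apply: leq_add; first by rewrite leq_mul2r lo orbT.
  exact/ltnW/ltn_pmod.
have hi' : (class_size k N u * k <= N + k)%N.
  apply: (leq_trans (n := (N %/ k).+1 * k)); first by rewrite leq_mul2r hi orbT.
  by rewrite mulSn addnC leq_add2r leq_divM.
have loR : N%:R <= (class_size k N u)%:R * k%:R + k%:R :> R.
  by rewrite -natrM -natrD ler_nat.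
have hiR : (class_size k N u)%:R * k%:R <= N%:R + k%:R :> R.
  by rewrite -natrM -natrD ler_nat.
rewrite ler_norml -(ler_pM2r k0R (- 1)) -(ler_pM2r k0R _ 1) mulrBl divfK ?gt_eqF // mulN1r mul1r.
by apply/andP; split; lra.
Qed.

Section Checkerboard.
Variables (R : realType) (k : nat) (W : seq R).
Hypotheses (k0 : (0 < k)%N) (sW : size W = k).

(** [nth] returns its default 0 on the empty list, so [checkerboard k [::] N a] is the random part,
    with zeros in place of the weights. *)
Lemma checkerboard_split (N : nat) (a : nat -> nat -> R) :
  checkerboard k W N a =
  checkerboard k W N (fun _ _ => 0) + checkerboard k [::] N a.
Proof.
apply/matrixP => i j; rewrite !mxE nth_nil.
by case: ifP => _; rewrite ?addr0 ?add0r.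
Qed.

Lemma checkerboard_sym (N : nat) (V : seq R) (a : nat -> nat -> R) :
  (checkerboard k V N a)^T = checkerboard k V N a.
Proof.
apply/matrixP => i j; rewrite !mxE eq_sym minnC maxnC.
by case: eqP => // ->.
Qed.

Lemma char_poly_checkerboard0 (N : nat) : (k <= N)%N ->
  char_poly (checkerboard k W N (fun _ _ => 0)) =
  'X^(N - k) * \prod_(u < k) ('X - (nth 0 W u * (class_size k N u)%:R)%:P).
Proof.
move=> kN.
(* The weight matrix factors through the [k] residue classes: [F] is the incidence matrix of indices
   and classes, [G] its transpose weighted by [W]. As the classes are disjoint, [G *m F] is
   diagonal. *)
pose F : 'M[R]_(N, k) := \matrix_(i, u) (i %% k == u)%N%:R.
pose G : 'M[R]_(k, N) := \matrix_(u, i) (nth 0 W u * (i %% k == u)%N%:R).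
have FG : checkerboard k W N (fun _ _ => 0) = F *m G.
  apply/matrixP => i j; rewrite !mxE.
  rewrite (bigD1 (Ordinal (ltn_pmod i k0))) //= !mxE /= eqxx mul1r.
  rewrite big1 ?addr0 => [|u ui]; last first.
    rewrite !mxE; case: eqP => [iu|_]; last by rewrite mul0r.
    by case/eqP: ui; apply: val_inj.
  by rewrite [(j %% k)%N == _]eq_sym; case: eqP => _; rewrite ?mulr1 ?mulr0.
have GF : char_poly (G *m F) =
    \prod_(u < k) ('X - (nth 0 W u * (class_size k N u)%:R)%:P).
  have GFE u v : (G *m F) u v = (nth 0 W u * (class_size k N u)%:R) *+ (u == v).
    rewrite mxE /class_size natr_sum mulr_sumr -sumrMnl; apply: eq_bigr => i _.
    rewrite !mxE; have [->|uv] := eqVneq u v.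
      by rewrite mulr1n -mulrA -natrM mulnb andbb.
    rewrite mulr0n; case: eqP => [->|_]; last by rewrite mulr0 mul0r.
    by case: eqP => [/val_inj/eqP|_]; rewrite ?(negbTE uv) ?mulr0.
  rewrite char_poly_trig.
    by apply: eq_bigr => u _; rewrite GFE eqxx.
  by apply/is_trig_mxP => u v uv; rewrite GFE -val_eqE ltn_eqF.
have Xk0 : 'X^k != 0 :> {poly R} by rewrite monic_neq0 ?monicXn.
apply: (mulfI Xk0).
by rewrite FG char_poly_mulmxC GF mulrA -exprD subnKC.
Qed.

Lemma le_spectral_pair_trace (N m : nat) (A : 'M[R]_N) U d (rho : R) :
  (0 < m)%N -> 0 <= rho -> spectral_pair A U d ->
  \tr (A ^+ m.*2) <= rho ^+ m.*2 -> forall i, `|d 0 i| <= rho.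
Proof.
move=> m0 rho0 AU; rewrite (spectral_pair_exp_trace _ AU) => trA i.
have ev (x : R) : 0 <= x ^+ m.*2 by rewrite -mul2n exprM exprn_ge0 // sqr_ge0.
have m2 : (0 < m.*2)%N by rewrite double_gt0.
rewrite -(ler_pXn2r m2) ?nnegrE //.
rewrite -normrX (ger0_norm (ev _)); apply: le_trans trA.
by rewrite (bigD1 i) //= lerDl; apply: sumr_ge0.
Qed.

Lemma spectral_pairN (N : nat) (A : 'M[R]_N) U d :
  spectral_pair A U d -> spectral_pair (- A) U (- d).
Proof.
move=> [Uu AE]; split => //.
rewrite map_mxN AE map_mxN.
have -> : diag_mx (- map_mx (real_complex R) d) = - diag_mx (map_mx (real_complex R) d).
  by rewrite raddfN.
by rewrite mulmxN mulNmx.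
Qed.

(** Labels are assigned where the spectrum is explicit: [Some v] marks the regime around [N v / k],
    [None] the small one, which takes the [N - k] zeros due to the rank and also the classes of
    weight 0. *)
Definition labelled_spectrum (N : nat) : seq (R * option R) :=
  nseq (N - k) (0, None) ++
  [seq (nth 0 W u * (class_size k N u)%:R,
        if nth 0 W u == 0 then None else Some (nth 0 W u)) | u <- iota 0 k].

Lemma count_labels (N : nat) (l : option R) :
  count_mem l [seq q.2 | q <- labelled_spectrum N] =
  ((N - k) * (l == None) +
   count (fun w : R => (if w == 0%R then None else Some w) == l) W)%N.
Proof.
rewrite /labelled_spectrum map_cat count_cat map_nseq count_nseq /= mulnC.
rewrite [None == l]eq_sym; congr addn.
rewrite -map_comp -[in RHS](mkseq_nth 0 W) sW /mkseq !count_map.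
exact: eq_count.
Qed.

(** Both spectra are sorted and the [i]-th eigenvalue of [A] inherits the label of the [i]-th one of
    [B]. Weyl's inequality costs [rho]; replacing a class size by [N / k] costs at most the absolute
    value of the weight, covered by the sum over [W]. *)
Lemma checkerboard_regimes (N m : nat) (a : nat -> nat -> R) (rho : R) :
  (k <= N)%N -> (0 < m)%N -> 0 <= rho ->
  \tr (checkerboard k [::] N a ^+ m.*2) <= rho ^+ m.*2 ->
  exists s : seq R, exists lab : seq (option R),
    eigenvalue_list (checkerboard k W N a) s /\
    size lab = N /\
    count (fun q => q.2 == None) (zip s lab) = (N - count (fun x : R => x != 0%R) W)%N /\
    (forall v : R, v != 0 ->
       count (fun q => q.2 == Some v) (zip s lab) = count_mem v W) /\
    all (fun q => match q.2 with
                  | None => `|q.1| <= rho + \sum_(x <- W) `|x|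
                  | Some v => `|q.1 - N%:R * v / k%:R| <= rho + \sum_(x <- W) `|x|
                  end) (zip s lab).
Proof.
move=> kN m0 rho0 trM.
set A := checkerboard k W N a; set M := checkerboard k [::] N a in trM.
set B := checkerboard k W N (fun _ _ => 0).
have [UA [dA specA]] := symmetric_spectral (checkerboard_sym N W a : A^T = A).
have [UB [dB specB]] := symmetric_spectral (checkerboard_sym N W (fun _ _ => 0) : B^T = B).
have [UM [dM specM]] := symmetric_spectral (checkerboard_sym N [::] a : M^T = M).
have dMrho := le_spectral_pair_trace m0 rho0 specM trM.
have AB : A - B = M by rewrite /A checkerboard_split addrAC subrr add0r.
(* Comparing first components only makes each label travel with its eigenvalue. *)
pose r := [rel p q : R * option R | p.1 <= q.1].
pose t := sort r (labelled_spectrum N).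
have tE : perm_eq t (labelled_spectrum N) by rewrite perm_sort.
pose s := sort <=%R [seq dA 0 i | i <- enum 'I_N].
pose lab := [seq q.2 | q <- t]; pose b := [seq q.1 | q <- t].
have sizet : size t = N.
  by rewrite (perm_size tE) size_cat size_nseq size_map size_iota subnK.
have sizes : size s = N by rewrite size_sort size_map size_enum_ord.
have bE : perm_eq b [seq dB 0 i | i <- enum 'I_N].
  apply: prod_XsubC_eq; rewrite (perm_big _ (perm_map _ tE)) /=.
  rewrite [RHS]big_map [RHS]big_enum /= -(spectral_pair_char_poly specB).
  rewrite char_poly_checkerboard0 // big_map big_cat /= big_nseq subr0.
  rewrite -Monoid.iteropE /=; congr (_ * _).
  by rewrite big_map /= -[k in iota _ k]subn0 -/(index_iota 0 k) big_mkord.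
have countE (d : 'rV[R]_N) (c : R) :
    count (fun x => (c < x)%R) [seq d 0 i | i <- enum 'I_N] = #|finset (fun i => (c < d 0 i)%R)|.
  rewrite count_map -sum1_count big_enum_cond -sum1_card.
  by apply: eq_bigl => i; rewrite inE.
have close : forall i, (i < N)%N -> `|nth 0 s i - nth 0 b i| <= rho.
  move=> i; rewrite -sizes; move: i; apply: sorted_close.
  - by rewrite sizes size_map sizet.
  - exact: sort_le_sorted.
  - rewrite sorted_map; apply: (sort_sorted (leT := r)).
    by move=> x y; exact: le_total.
  - move=> c; rewrite (permP (permEl (perm_sort _ _))) (permP bE) !countE.
    apply: (weyl_count (W := UM) (c := dM)) specA specB _ _; first by rewrite AB.
    by move=> i; apply: le_trans (ler_norm _) _.
  (* The reverse comparison uses [B - A = - M], whose eigenvalues obey the same bound. *)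
  - move=> c; rewrite (permP (permEl (perm_sort _ _))) (permP bE) !countE.
    apply: (weyl_count (W := UM) (c := - dM)) specB specA _ _.
      by rewrite -opprB AB; exact: spectral_pairN.
    by move=> i; rewrite mxE; apply: le_trans (ler_norm _) _; rewrite normrN.
have countlab l : count (fun q : R * option R => q.2 == l) (zip s lab) =
    ((N - k) * (l == None) +
    count (fun w : R => (if w == 0%R then None else Some w) == l) W)%N.
  rewrite -count_labels -(permP (perm_map _ tE)) -/lab.
  rewrite -[in RHS](@unzip2_zip _ _ s lab) ?count_map //.
  by rewrite sizes size_map sizet.
exists s, lab; split; first split => //.
  rewrite (spectral_pair_char_poly specA) (perm_big _ (permEl (perm_sort _ _))) /=.
  by rewrite big_map big_enum.
split; first by rewrite size_map.
split.
  rewrite countlab eqxx muln1.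
  (* With [x] nonzero weights, the [k - x] zero weights and the other [N - k] zeros add up to
     [N - x]. *)
  have -> : count (fun w : R => (if w == 0%R then None else Some w) == None) W =
      (k - count (fun x : R => x != 0%R) W)%N.
    rewrite -sW -(count_predC (fun x : R => x != 0) W) addKn.
    by apply: eq_count => w /=; case: (w == 0).
  by rewrite addnBA ?subnK // -sW count_size.
split.
  move=> v v0; rewrite countlab muln0 add0n; apply: eq_count => w /=.
  have [->|w0] := eqVneq w 0; first by rewrite [RHS]eq_sym (negbTE v0).
  by [].
apply/(all_nthP (0, None)) => i; rewrite size_zip sizes size_map sizet minnn => iN.
rewrite nth_zip ?sizes ?size_map ?sizet //=.
have := close i iN; rewrite /lab /b !(nth_map (0, None)) ?sizet //.
have : nth (0, None) t i \in labelled_spectrum N.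
  by rewrite -(perm_mem tE) mem_nth ?sizet.
move: (nth _ t i) => q; rewrite mem_cat => /orP [|].
  rewrite mem_nseq => /andP [_ /eqP ->] /=; rewrite subr0 => /le_trans; apply.
  by rewrite lerDl; apply: sumr_ge0.
case/mapP => u; rewrite mem_iota add0n => /= uk -> /=.
case: eqP => [->|_] su.
  rewrite mul0r subr0 in su; apply: le_trans su _.
  by rewrite lerDl; apply: sumr_ge0.
set w := nth 0 W u.
have -> : nth 0 s i - N%:R * w / k%:R = (nth 0 s i - w * (class_size k N u)%:R) +
   w * ((class_size k N u)%:R - N%:R / k%:R) by ring.
apply: le_trans (ler_normD _ _) _; apply: lerD => //.
have wW : w \in W by rewrite mem_nth // sW.
rewrite (big_rem _ wW) /=; apply: (@le_trans _ _ `|w|).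
  by rewrite normrM ler_piMr // class_size_close.
by rewrite lerDl; apply: sumr_ge0.
Qed.

End Checkerboard.

(** * Independence *)

Section Law.
Import HBNNSimple.
Context d (T : measurableType d) (R : realType) (P : probability T R).
Variables (X Y : T -> R) (g : T -> R) (c : R).
Hypotheses (mX : measurable_fun setT X) (mY : measurable_fun setT Y).
Hypotheses (mg : measurable_fun setT g) (g0 : forall w, 0 <= g w).
Hypothesis XY : forall B : set R, measurable B ->
  (\int[P]_w (\1_B (X w) * g w)%:E = c%:E * P (Y @^-1` B))%E.

Let simple_law (f : {nnsfun R >-> R}) :
  (\int[P]_w (f (X w) * g w)%:E = c%:E * \int[P]_w (f (Y w))%:E)%E.
Proof.
have mpre (Z : T -> R) r : measurable_fun setT Z -> measurable (Z @^-1` (f @^-1` [set r])).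
  by move=> mZ; rewrite -[_ @^-1` _]setTI; apply: mZ.
have mind (Z : T -> R) r : measurable_fun setT Z ->
    measurable_fun setT (fun w => \1_(f @^-1` [set r]) (Z w) : R).
  by move=> mZ; apply: measurableT_comp.
have fI r : (range f) r -> 0 <= r by move=> [x _ <-].
transitivity (\sum_(r \in range f) \int[P]_w (r * (\1_(f @^-1` [set r]) (X w) * g w))%:E)%E.
  rewrite -ge0_integral_fsum //; last 2 first.
  - move=> r; apply/measurable_EFinP; apply: measurable_funM => //.
    by apply: measurable_funM => //; exact: mind.
  - move=> r w _; rewrite lee_fin mulrA mulr_ge0 //.
    exact: nnfun_muleindic_ge0.
  apply: eq_integral => w _; rewrite fsumEFin //; congr EFin.
  rewrite {1}(fimfunE f) mulrC mulr_fsumr //.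
  by apply: eq_fsbigr => r _; rewrite mulrC mulrA.
transitivity (\sum_(r \in range f) c%:E * (r%:E * P (Y @^-1` (f @^-1` [set r]))))%E.
  apply: eq_fsbigr => r /[!inE] fr0.
  under eq_integral do rewrite EFinM.
  rewrite ge0_integralZl //; last 3 first.
  - by apply/measurable_EFinP/measurable_funM => //; exact: mind.
  - by move=> w _; rewrite lee_fin mulr_ge0.
  - by rewrite lee_fin fI.
  by rewrite XY // muleCA.
rewrite -ge0_mule_fsumr; last first.
  (* A negative [r] is not a value of [f], so its level set is empty and the term is 0. *)
  move=> r; have [r0|r0] := leP 0 r; first by rewrite mule_ge0 // lee_fin.
  rewrite preimage_nnfun0 // preimage_set0 measure0 mule0 //.
congr (_ * _)%E.
transitivity (\int[P]_w (\sum_(r \in range f) (r * \1_(f @^-1` [set r]) (Y w))%:E))%E; last first.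
  by apply: eq_integral => w _; rewrite [in RHS](fimfunE f) fsumEFin.
rewrite ge0_integral_fsum //; last 2 first.
- by move=> r; apply/measurable_EFinP/measurable_funM => //; exact: mind.
- by move=> r w _; rewrite lee_fin; exact: nnfun_muleindic_ge0.
apply: eq_fsbigr => r /[!inE] fr0.
under eq_integral do rewrite EFinM.
rewrite ge0_integralZl //; last 2 first.
- by apply/measurable_EFinP; exact: mind.
- by rewrite lee_fin fI.
congr (_ * _)%E; rewrite -[LHS]mul1e -(setIT (Y @^-1` _)).
rewrite -integral_indic ?mul1e //; exact: mpre.
Qed.

(** [XY] is the case of indicators; simple functions follow by linearity, nonnegative ones by
    monotone convergence. Used with [Y = X] and [g] the product of the other factors, and with
    [g = 1] to transfer integrals between variables of the same law. *)
Lemma integral_law (f : R -> R) : measurable_fun setT f -> (forall x, 0 <= f x) ->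
  (\int[P]_w (f (X w) * g w)%:E = c%:E * \int[P]_w (f (Y w))%:E)%E.
Proof.
move=> mf f0.
have mfE : measurable_fun setT (EFin \o f) by apply/measurable_EFinP.
pose f_ := nnsfun_approx measurableT mfE.
have f_cvg x : (f_ n x)%:E @[n --> \oo] --> (f x)%:E.
  by apply: (@cvg_nnsfun_approx _ _ _ setT measurableT _ mfE) => // y _; rewrite lee_fin.
have f_nd x : {homo (fun n => f_ n x) : m n / (m <= n)%N >-> m <= n}.
  by move=> m n mn; exact/lefP/nd_nnsfun_approx.
have lim1 : (\int[P]_w (f_ n (X w) * g w)%:E)%E @[n --> \oo]
    --> (\int[P]_w (f (X w) * g w)%:E)%E.
  have -> : (\int[P]_w (f (X w) * g w)%:E =
      \int[P]_w limn (fun n => (f_ n (X w) * g w)%:E))%E.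
    apply: eq_integral => w _; apply/esym/cvg_lim => //.
    rewrite EFinM; under eq_fun do rewrite EFinM.
    by apply: cvgeZr.
  apply: cvg_monotone_convergence => //.
  - by move=> n; apply/measurable_EFinP/measurable_funM => //; exact: measurableT_comp.
  - by move=> n w _; rewrite lee_fin mulr_ge0.
  - by move=> w _ m n mn; rewrite lee_fin ler_wpM2r // f_nd.
have lim2 : (\int[P]_w (f_ n (Y w))%:E)%E @[n --> \oo] --> (\int[P]_w (f (Y w))%:E)%E.
  have -> : (\int[P]_w (f (Y w))%:E = \int[P]_w limn (fun n => (f_ n (Y w))%:E))%E.
    by apply: eq_integral => w _; apply/esym/cvg_lim.
  apply: cvg_monotone_convergence => //.
  - by move=> n; apply/measurable_EFinP; exact: measurableT_comp.
  - by move=> n w _; rewrite lee_fin.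
  - by move=> w _ m n mn; rewrite lee_fin f_nd.
have eq12 : (fun n => \int[P]_w (f_ n (X w) * g w)%:E)%E =
    (fun n => c%:E * \int[P]_w (f_ n (Y w))%:E)%E.
  by apply/funext => n; exact: simple_law.
rewrite eq12 in lim1.
have lim3 : (c%:E * \int[P]_w (f_ n (Y w))%:E)%E @[n --> \oo]
  --> (c%:E * \int[P]_w (f (Y w))%:E)%E by apply: cvgeZl.
exact: (cvg_unique _ lim1 lim3).
Qed.

End Law.

Section Independence.
Context d (T : measurableType d) (R : realType) (P : probability T R).
Variables (I : eqType) (D : set I) (X : I -> T -> R).
Hypothesis mX : forall i, D i -> measurable_fun setT (X i).
Hypothesis indX : mutually_independent P D X.

Let mfX i (h : R -> R) : D i -> measurable_fun setT h ->
  measurable_fun setT (fun w => h (X i w)).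
Proof. by move=> /mX mXi mh; apply: measurableT_comp. Qed.

(* Independence is the case of indicators; these are replaced by arbitrary
   functions one at a time, since with the other factors fixed both sides are
   measures in the set of the indicator being replaced. *)
Lemma integral_prod_indep_aux (L K : seq I) (f : I -> R -> R) (B : I -> set R)
    (c : I -> R) :
  uniq (L ++ K) -> (forall i, i \in L ++ K -> D i) ->
  (forall i, i \in L -> measurable_fun setT (f i)) ->
  (forall i x, i \in L -> 0 <= f i x) ->
  (forall i, i \in K -> measurable (B i)) ->
  (forall i, i \in L -> (\int[P]_w (f i (X i w))%:E = (c i)%:E)%E) ->
  (\int[P]_w ((\prod_(i <- L) f i (X i w)) * \prod_(i <- K) \1_(B i) (X i w))%:E =
   (\prod_(i <- L) c i * \prod_(i <- K) fine (P (X i @^-1` B i)))%:E)%E.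
Proof.
elim: L K B => [|i L IHL] K B.
  (* With indicators only, the product is the indicator of an intersection, and independence applies
     as defined. *)
  move=> uK DK _ _ mB _.
  have mpre i : i \in K -> measurable (X i @^-1` B i).
    by move=> iK; rewrite -[_ @^-1` _]setTI; apply: mX => //; [exact: DK|exact: mB].
  have mcap : measurable (\bigcap_(i in [set` K]) (X i @^-1` B i)).
    by apply: fin_bigcap_measurable => // i; exact: mpre.
  rewrite big_nil mul1r.
  transitivity (\int[P]_w (\1_(\bigcap_(i in [set` K]) (X i @^-1` B i)) w)%:E)%E.
    apply: eq_integral => w _; rewrite big_nil mul1r; congr EFin.
    rewrite indicE; case: (boolP (_ \in _)); rewrite ?inE ?notin_setE => wB.
      rewrite big_seq big1 // => i iK; rewrite indicE mem_set //.
      exact: (wB i).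
    have [i [iK wi]] : exists i, i \in K /\ ~ B i (X i w).
      apply: contrapT => nex; apply: wB => i /= iK; apply: contrapT => wi.
      by apply: nex; exists i.
    rewrite (big_rem i) //= indicE memNset // mul0r //.
  rewrite integral_indic // setIT.
  transitivity (\prod_(i <- K) P (X i @^-1` B i))%E; first exact: indX.
  rewrite -prodEFin; apply: eq_big_seq => i iK.
  by rewrite fineK // fin_num_measure //; exact: mpre.
rewrite cat_cons /= => /andP [iLK uLK] DLK mf f0 mB fc.
have Di : D i by apply: DLK; rewrite mem_head.
have iL : i \in i :: L by rewrite mem_head.
have LiL j : j \in L -> j \in i :: L by rewrite inE orbC => ->.
pose g w := (\prod_(j <- L) f j (X j w)) * \prod_(j <- K) \1_(B j) (X j w).
pose cg := \prod_(j <- L) c j * \prod_(j <- K) fine (P (X j @^-1` B j)).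
have mg : measurable_fun setT g.
  apply: measurable_funM; apply: measurable_prod => j jL.
    by apply: mfX; [apply: DLK; rewrite inE mem_cat jL orbT|by apply: mf; apply: LiL].
  by apply: mfX; [apply: DLK; rewrite inE mem_cat jL !orbT|by apply: measurable_indic; exact: mB].
have g0 w : 0 <= g w.
  apply: mulr_ge0; rewrite big_seq; apply: prodr_ge0 => j jL; last by [].
  by apply: f0; apply: LiL.
(* Induction hypothesis with [i] moved from [L] to [K], carrying the set [A]; [B'] agrees with [B]
   on [K] because [i] is not in [K]. *)
have step (A : set R) : measurable A ->
    (\int[P]_w (\1_A (X i w) * g w)%:E = cg%:E * P (X i @^-1` A))%E.
  move=> mA; pose B' j := if j == i then A else B j.
  have B'K j : j \in K -> B' j = B j.
    rewrite /B'; case: eqP => // -> iK.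
    by rewrite mem_cat iK orbT in iLK.
  have := IHL (i :: K) B'; rewrite !big_cons.
  have -> : B' i = A by rewrite /B' eqxx.
  have mpre : measurable (X i @^-1` A) by rewrite -[_ @^-1` _]setTI; apply: mX.
  rewrite -[P (X i @^-1` A)]fineK ?fin_num_measure // -EFinM.
  have -> : cg * fine (P (X i @^-1` A)) = \prod_(j <- L) c j *
      (fine (P (X i @^-1` A)) * \prod_(j <- K) fine (P (X j @^-1` B' j))).
    rewrite /cg -mulrA [X in _ * X]mulrC; congr (_ * (_ * _)).
    by apply: eq_big_seq => j jK; rewrite B'K.
  move=> <- //.
  - apply: eq_integral => w _; rewrite big_cons -/(B' i).
    have -> : B' i = A by rewrite /B' eqxx.
    rewrite /g mulrCA; congr (_ * (_ * _))%:E.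
    by apply: eq_big_seq => j jK; rewrite B'K.
  - rewrite -cat1s uniq_catCA cat1s /= iLK //.
  - by move=> j; rewrite -cat1s mem_cat mem_cat orbCA -!mem_cat cat1s => /DLK.
  - by move=> j /LiL; exact: mf.
  - by move=> j x /LiL; exact: f0.
  - move=> j; rewrite inE /B'; case: eqP => //= _; exact: mB.
  - by move=> j /LiL; exact: fc.
have := integral_law (mX Di) (mX Di) mg g0 step (mf _ iL) (fun x => f0 _ x iL).
rewrite fc // -EFinM => law.
rewrite big_cons -mulrA -/cg mulrC.
transitivity (\int[P]_w (f i (X i w) * g w)%:E)%E.
  by apply: eq_integral => w _; rewrite big_cons /g mulrA.
exact: law.
Qed.

Lemma integral_prod_indep (J : seq I) (f : I -> R -> R) (c : I -> R) :
  uniq J -> (forall i, i \in J -> D i) ->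
  (forall i, i \in J -> measurable_fun setT (f i)) ->
  (forall i x, i \in J -> 0 <= f i x) ->
  (forall i, i \in J -> (\int[P]_w (f i (X i w))%:E = (c i)%:E)%E) ->
  (\int[P]_w (\prod_(i <- J) f i (X i w))%:E = (\prod_(i <- J) c i)%:E)%E.
Proof.
move=> uJ DJ mf f0 fc.
have := @integral_prod_indep_aux J [::] f (fun=> setT) c.
rewrite cats0 big_nil mulr1 => <- //.
by apply: eq_integral => w _; rewrite big_nil mulr1.
Qed.

(** The product formula applies to the absolute values, which are nonnegative, and shows that their
    product has a finite integral. *)
Lemma integrable_prod_indep (J : seq I) (f : I -> R -> R) :
  uniq J -> (forall i, i \in J -> D i) ->
  (forall i, i \in J -> measurable_fun setT (f i)) ->
  (forall i, i \in J -> P.-integrable setT (fun w => (f i (X i w))%:E)) ->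
  P.-integrable setT (fun w => (\prod_(i <- J) f i (X i w))%:E).
Proof.
move=> uJ DJ mf intf; apply/integrableP; split.
  apply/measurable_EFinP; apply: measurable_prod => i iJ.
  by apply: mfX; [exact: DJ|exact: mf].
under eq_integral do rewrite abse_EFin normr_prod.
rewrite (@integral_prod_indep J (fun i x => `|f i x|)
  (fun i => fine (\int[P]_w (`|f i (X i w)|)%:E))) ?ltry //.
- by move=> i iJ; apply: measurableT_comp => //; exact: mf.
- move=> i iJ; rewrite fineK // ge0_fin_numE ?integral_ge0 //.
  by have /integrableP [_] := intf i iJ.
Qed.

Let integrable_part (i : I) (f h : R -> R) : D i -> measurable_fun setT h ->
  (forall x, `|h x| <= `|f x|) ->
  P.-integrable setT (fun w => (f (X i w))%:E) ->
  P.-integrable setT (fun w => (h (X i w))%:E).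
Proof.
move=> Di mh hf; apply: le_integrable => //.
  by apply/measurable_EFinP; exact: mfX.
by move=> w _; rewrite lee_fin.
Qed.

Let le_funrpos (f : R -> R) x : `|f^\+ x| <= `|f x|.
Proof.
rewrite /numfun.funrpos ger0_norm ?le_max ?lexx ?orbT // ge_max normr_ge0.
by rewrite ler_norm.
Qed.

Let le_funrneg (f : R -> R) x : `|f^\- x| <= `|f x|.
Proof.
rewrite /numfun.funrneg ger0_norm ?le_max ?lexx ?orbT // ge_max normr_ge0.
by rewrite -normrN ler_norm.
Qed.

(** The positive and negative parts of [X e] each factor out with the same cofactor, and they have
    equal integrals because [X e] is centered. *)
Let integral_centered_nonneg (e : I) (J : seq I) (f : I -> R -> R) :
  uniq (e :: J) -> (forall i, i \in e :: J -> D i) ->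
  (forall i, i \in J -> measurable_fun setT (f i)) ->
  (forall i, i \in J -> P.-integrable setT (fun w => (f i (X i w))%:E)) ->
  (forall i x, i \in J -> 0 <= f i x) ->
  P.-integrable setT (fun w => (X e w)%:E) ->
  (\int[P]_w (X e w)%:E = 0)%E ->
  (\int[P]_w (X e w * \prod_(i <- J) f i (X i w))%:E = 0)%E.
Proof.
move=> /= /andP [eJ uJ] DJ mf intf f0 intX X0.
have De : D e by apply: DJ; rewrite mem_head.
pose G w := \prod_(i <- J) f i (X i w).
have part (h : R -> R) : measurable_fun setT h -> (forall x, 0 <= h x) ->
    (forall x, `|h x| <= `|x|) ->
    P.-integrable setT (fun w => (h (X e w) * G w)%:E) /\
    (\int[P]_w (h (X e w) * G w)%:E = \int[P]_w (h (X e w))%:E *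
     (\prod_(i <- J) fine (\int[P]_w (f i (X i w))%:E))%:E)%E.
  move=> mh h0 hx; pose f' i := if i == e then h else f i.
  have f'J i : i \in J -> f' i = f i.
    by rewrite /f'; case: eqP => // ->; rewrite (negbTE eJ).
  have f'e : f' e = h by rewrite /f' eqxx.
  have GE w : h (X e w) * G w = \prod_(i <- e :: J) f' i (X i w).
    by rewrite big_cons f'e; congr (_ * _); apply: eq_big_seq => i iJ; rewrite f'J.
  have mf' i : i \in e :: J -> measurable_fun setT (f' i).
    by rewrite inE => /orP [/eqP ->|iJ]; rewrite ?f'e // f'J //; exact: mf.
  have intf' i : i \in e :: J -> P.-integrable setT (fun w => (f' i (X i w))%:E).
    rewrite inE => /orP [/eqP ->|iJ]; last by rewrite f'J //; exact: intf.
    by rewrite f'e; apply: (@integrable_part e id).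
  have f'0 i x : i \in e :: J -> 0 <= f' i x.
    by rewrite inE => /orP [/eqP ->|iJ]; rewrite ?f'e // f'J //; exact: f0.
  split.
    under eq_fun do rewrite GE.
    by apply: integrable_prod_indep => //; rewrite /= eJ uJ.
  under eq_integral do rewrite GE.
  rewrite (@integral_prod_indep _ f' (fun i => fine (\int[P]_w (f' i (X i w))%:E))) //.
  - rewrite big_cons f'e EFinM fineK; last by rewrite -f'e integrable_fin_num // intf' ?mem_head.
    congr (_ * _%:E)%E; apply: eq_big_seq => i iJ; by rewrite f'J.
  - by rewrite /= eJ uJ.
  - by move=> i iJ; rewrite fineK // integrable_fin_num // intf'.
have mid : measurable_fun setT (@idfun R) by exact: measurable_id.
have [ip ep] := part (@idfun R)^\+ (measurable_funrpos mid) (funrpos_ge0 _) (le_funrpos _).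
have [im em] := part (@idfun R)^\- (measurable_funrneg mid) (funrneg_ge0 _) (le_funrneg _).
have split_id x : x = (@idfun R)^\+ x - (@idfun R)^\- x.
  by rewrite -[LHS]/(@idfun R x) -{1}(funrposBneg (@idfun R)).
have intp : P.-integrable setT (fun w => ((@idfun R)^\+ (X e w))%:E).
  exact: (integrable_part De (measurable_funrpos mid) (le_funrpos _) intX).
have intm : P.-integrable setT (fun w => ((@idfun R)^\- (X e w))%:E).
  exact: (integrable_part De (measurable_funrneg mid) (le_funrneg _) intX).
have pm : (\int[P]_w ((@idfun R)^\+ (X e w))%:E = \int[P]_w ((@idfun R)^\- (X e w))%:E)%E.
  have := integralB_EFin measurableT intp intm.
  have -> : (\int[P]_w (((@idfun R)^\+ (X e w))%:E - ((@idfun R)^\- (X e w))%:E) = 0)%E.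
    by rewrite -[RHS]X0; apply: eq_integral => w _; rewrite -EFinB -split_id.
  have fp := integrable_fin_num measurableT intp.
  have fm := integrable_fin_num measurableT intm.
  rewrite -(fineK fp) -(fineK fm) -EFinB => -[/esym/eqP].
  by rewrite subr_eq0 => /eqP ->.
transitivity (\int[P]_w (((@idfun R)^\+ (X e w) * G w)%:E - ((@idfun R)^\- (X e w) * G w)%:E))%E.
  by apply: eq_integral => w _; rewrite -EFinB -mulrBl -split_id.
rewrite (integralB_EFin measurableT ip im) ep em pm subee //.
by rewrite fin_numM // integrable_fin_num.
Qed.

(** Induction on [J], the factors of arbitrary sign: the first is split into positive and negative
    parts, and each part joins the nonnegative factors [K]. *)
Lemma integral_prod_indep_centered (e : I) (J K : seq I) (f : I -> R -> R) :
  uniq (e :: J ++ K) -> (forall i, i \in e :: J ++ K -> D i) ->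
  (forall i, i \in J ++ K -> measurable_fun setT (f i)) ->
  (forall i, i \in J ++ K -> P.-integrable setT (fun w => (f i (X i w))%:E)) ->
  (forall i x, i \in K -> 0 <= f i x) ->
  P.-integrable setT (fun w => (X e w)%:E) ->
  (\int[P]_w (X e w)%:E = 0)%E ->
  (\int[P]_w (X e w * \prod_(i <- J ++ K) f i (X i w))%:E = 0)%E.
Proof.
move=> uJK DJK mf intf f0 intX X0.
elim: J K f uJK DJK mf intf f0 => [|j J IHJ] K f uJK DJK mf intf f0.
  exact: integral_centered_nonneg.
have De : D e by apply: DJK; rewrite mem_head.
have /= /andP[eJK /andP [jJK uJ]] := uJK.
have pJK : perm_eq (J ++ j :: K) (j :: J ++ K) by rewrite perm_catC /= perm_cons perm_catC.
have Dj : D j by apply: DJK; rewrite !inE eqxx orbT.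
have jin : j \in (j :: J) ++ K by rewrite mem_head.
have part (h : R -> R) : measurable_fun setT h -> (forall x, 0 <= h x) ->
    (forall x, `|h x| <= `|f j x|) ->
    P.-integrable setT (fun w => (X e w * (h (X j w) * \prod_(i <- J ++ K) f i (X i w)))%:E) /\
    (\int[P]_w (X e w * (h (X j w) * \prod_(i <- J ++ K) f i (X i w)))%:E = 0)%E.
  (* The identity at [e] makes the whole integrand a single product over [e :: J ++ j :: K],
     integrable by independence. *)
  move=> mh h0 hx; pose f' i := if i == j then h else if i == e then id else f i.
  have ej : (e == j) = false.
    by apply/negbTE; move: eJK; rewrite inE negb_or => /andP [].
  have f'JK i : i \in J ++ K -> f' i = f i.
    move=> iJK; rewrite /f'; case: eqP => [ij|_].
      by rewrite -ij iJK in jJK.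
    by case: eqP => // ie; rewrite -ie inE iJK orbT in eJK.
  have f'j : f' j = h by rewrite /f' eqxx.
  have f'e : f' e = id by rewrite /f' ej eqxx.
  have GE w : h (X j w) * \prod_(i <- J ++ K) f i (X i w) =
      \prod_(i <- J ++ j :: K) f' i (X i w).
    rewrite (perm_big _ pJK) /= big_cons f'j; congr (_ * _).
    by apply: eq_big_seq => i iJ; rewrite f'JK.
  have mf' i : i \in J ++ j :: K -> measurable_fun setT (f' i).
    rewrite (perm_mem pJK) inE => /orP [/eqP ->|iJ]; rewrite ?f'j // f'JK //.
    by apply: mf; rewrite inE iJ orbT.
  have intf' i : i \in J ++ j :: K -> P.-integrable setT (fun w => (f' i (X i w))%:E).
    rewrite (perm_mem pJK) inE => /orP [/eqP ->|iJ].
      by rewrite f'j; apply: (integrable_part Dj mh hx); apply: intf.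
    by rewrite f'JK //; apply: intf; rewrite inE iJ orbT.
  have uJ' : uniq (e :: J ++ j :: K).
    by rewrite /= (perm_mem pJK) (perm_uniq pJK) eJK /= jJK.
  have DJ' i : i \in e :: J ++ j :: K -> D i.
    by rewrite inE (perm_mem pJK) => iJ; apply: DJK; rewrite inE.
  split.
    under eq_fun do rewrite GE.
    have -> : (fun w => (X e w * \prod_(i <- J ++ j :: K) f' i (X i w))%:E) =
        (fun w => (\prod_(i <- e :: J ++ j :: K) f' i (X i w))%:E).
      by apply/funext => w; rewrite big_cons f'e.
    apply: integrable_prod_indep => //.
      by move=> i; rewrite inE => /orP [/eqP ->|]; [rewrite f'e|exact: mf'].
    by move=> i; rewrite inE => /orP [/eqP ->|]; [rewrite f'e|exact: intf'].
  under eq_integral do rewrite GE.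
  apply: IHJ => //.
  move=> i x; rewrite inE => /orP [/eqP ->|iK]; first by rewrite f'j.
  by rewrite f'JK ?mem_cat ?iK ?orbT //; exact: f0.
have [ip ep] := part (f j)^\+ (measurable_funrpos (mf _ jin)) (funrpos_ge0 _) (le_funrpos _).
have [im em] := part (f j)^\- (measurable_funrneg (mf _ jin)) (funrneg_ge0 _) (le_funrneg _).
pose G w := \prod_(i <- J ++ K) f i (X i w).
transitivity (\int[P]_w ((X e w * ((f j)^\+ (X j w) * G w))%:E -
    (X e w * ((f j)^\- (X j w) * G w))%:E))%E.
  apply: eq_integral => w _; rewrite -EFinB -mulrBr -mulrBl big_cons.
  by rewrite -{1}(funrposBneg (f j)).
by rewrite (integralB_EFin measurableT ip im) ep em subee.
Qed.

End Independence.

(** * The moment method *)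

(** Serves to fix [N], passing from the triples that index all entries to the pairs that index one
    matrix. The left inverse [psi] transports the sets [B]. *)
Lemma mutually_independent_reindex (d : measure_display) (T : measurableType d)
    (R : realType) (P : probability T R) (I J : eqType) (D : set I) (E : set J)
    (X : I -> T -> R) (phi : J -> I) (psi : I -> J) :
  cancel phi psi -> (forall j, E j -> D (phi j)) ->
  mutually_independent P D X -> mutually_independent P E (X \o phi).
Proof.
move=> phiK ED indX K B uK EK mB.
have -> : \bigcap_(j in [set` K]) ((X \o phi) j @^-1` B j) =
    \bigcap_(i in [set` map phi K]) (X i @^-1` B (psi i)).
  apply/seteqP; split => w /= Bw i /=.
    by move=> /mapP [j jK ->]; rewrite phiK; exact: (Bw j).
  by move=> iK; have := Bw (phi i) (map_f phi iK); rewrite phiK.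
rewrite indX ?map_inj_uniq //; last 3 first.
- exact: can_inj phiK.
- by move=> i /mapP [j jK ->]; apply/ED/EK.
- by move=> i /mapP [j jK ->]; rewrite phiK; exact: mB.
by rewrite big_map; apply: eq_bigr => j _; rewrite phiK.
Qed.

Section WalkWeight.
Variables (R : realType) (k n : nat) (b : nat -> nat -> R).

Lemma walk_edges_lt (i : 'I_n) (p : seq 'I_n) e :
  e \in walk_edges i p -> (e.1 <= e.2 < n)%N.
Proof.
elim: p i => //= j p IHp i; rewrite inE => /orP [/eqP -> /=|]; last exact: IHp.
by rewrite geq_min leq_max leqnn /= gtn_max !ltn_ord.
Qed.

Definition cross_edge (e : nat * nat) := (e.1 %% k != e.2 %% k)%N.

Lemma walk_weight_checkerboard (i : 'I_n) (p : seq 'I_n) :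
  walk_weight (checkerboard k [::] n b) i p =
  if all cross_edge (walk_edges i p)
  then \prod_(e <- walk_edges i p) b e.1 e.2 else 0.
Proof.
elim: p i => [|j p IHp] i /=; first by rewrite big_nil.
rewrite IHp mxE nth_nil /cross_edge /=.
have -> : (minn i j %% k == maxn i j %% k)%N = (i %% k == j %% k)%N.
  by case: leqP => // _; rewrite eq_sym.
case: eqP => _ /=; first by rewrite mul0r.
by case: ifP => _; rewrite ?mulr0 // big_cons.
Qed.
End WalkWeight.

Section Moments.
Context (d : measure_display) (T : measurableType d) (R : realType).
Variables (P : probability T R) (k : nat) (a : nat -> nat -> nat -> T -> R).
Hypothesis ma : forall N i j, (i < j < N)%N -> measurable_fun setT (a N i j).
Hypothesis id_a : forall N i j N' i' j', (i < j < N)%N -> (i' < j' < N')%N ->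
  same_distribution P (a N i j) (a N' i' j').
Hypothesis ind_a : mutually_independent P [set t | (t.1.2 < t.2 < t.1.1)%N]
  (fun t : nat * nat * nat => a t.1.1 t.1.2 t.2).
Hypothesis int_a : forall N i j, (i < j < N)%N -> forall p : nat,
  P.-integrable setT (fun w => (`|a N i j w| ^+ p)%:E).
Hypothesis a_mean : forall N i j, (i < j < N)%N -> (\int[P]_w (a N i j w)%:E = 0)%E.

(** The entry [a 2 0 1] represents the common law of all entries. *)
Definition abs_moment (p : nat) : R := fine (\int[P]_w (`|a 2 0 1 w| ^+ p)%:E).

Lemma abs_moment_ge0 p : 0 <= abs_moment p.
Proof. by apply/fine_ge0/integral_ge0 => w _; rewrite lee_fin exprn_ge0. Qed.

Let mnormX (p : nat) : measurable_fun setT (fun x : R => `|x| ^+ p).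
Proof. by apply: measurable_funX; exact: normr_measurable. Qed.

Lemma integral_abs_moment N i j p : (i < j < N)%N ->
  (\int[P]_w (`|a N i j w| ^+ p)%:E = (abs_moment p)%:E)%E.
Proof.
move=> ijN; have ij2 : (0 < 1 < 2)%N by [].
have step (B : set R) : measurable B ->
    (\int[P]_w (\1_B (a N i j w) * 1)%:E = 1%:E * P (a 2 0 1 @^-1` B))%E.
  move=> mB; rewrite mul1e -(id_a ijN ij2 mB).
  under eq_integral do rewrite mulr1.
  rewrite -[RHS]/(P (a N i j @^-1` B)) -(setIT (_ @^-1` _)) -integral_indic //.
  by rewrite -[_ @^-1` _]setTI; apply: (ma ijN).
have m1 : measurable_fun setT (fun _ : T => 1 : R) by exact: measurable_cst.
have := integral_law (ma ijN) (ma ij2) m1 (fun=> ler01) step (mnormX p)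
  (fun x => exprn_ge0 p (normr_ge0 x)).
under eq_integral do rewrite mulr1.
rewrite mul1e => ->; rewrite fineK // integrable_fin_num //; exact: int_a.
Qed.

Let D N : set (nat * nat) := [set e | (e.1 < e.2 < N)%N].

Let mX N e : D N e -> measurable_fun setT (a N e.1 e.2).
Proof. by move=> eN; exact: ma. Qed.

Let ind_N N : mutually_independent P (D N) (fun e => a N e.1 e.2).
Proof.
pose phi (e : nat * nat) : nat * nat * nat := (N, e.1, e.2).
pose psi (t : nat * nat * nat) : nat * nat := (t.1.2, t.2).
have phiK : cancel phi psi by case.
by apply: (mutually_independent_reindex (E := D N) phiK _ ind_a).
Qed.

(** Dominates the absolute moments up to order [l]; the summand 1 makes its powers nondecreasing in
    the exponent. *)
Definition moment_bound (l : nat) : R := 1 + \sum_(p < l.+1) abs_moment p.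

Lemma moment_bound_ge1 l : 1 <= moment_bound l.
Proof. by rewrite lerDl; apply: sumr_ge0 => p _; exact: abs_moment_ge0. Qed.

Lemma abs_moment_le_bound l p : (p <= l)%N -> abs_moment p <= moment_bound l.
Proof.
move=> pl; rewrite /moment_bound (bigD1 (Ordinal (pl : p < l.+1)%N)) //= addrCA.
rewrite lerDl addr_ge0 //; apply: sumr_ge0 => q _; exact: abs_moment_ge0.
Qed.

(** Three kinds of walks: an edge inside a residue class makes the weight 0; an edge crossed exactly
    once makes the mean 0; otherwise at most [m + 1] vertices occur and absolute moments bound the
    mean. *)
Lemma walk_weight_moment N m (i : 'I_N) (p : seq 'I_N) : size p = m.*2 ->
  let W w := walk_weight (checkerboard k [::] N (fun i j => a N i j w)) i p in
  P.-integrable setT (fun w => (W w)%:E) /\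
  (\int[P]_w (W w)%:E <=
   (moment_bound m.*2 ^+ m.*2 * (size (undup (i :: p)) <= m.+1)%N%:R)%:E)%E.
Proof.
move=> sp W; pose E := walk_edges i p; pose J := undup E.
have K0 : 0 <= moment_bound m.*2 by apply: le_trans (moment_bound_ge1 _).
have [cE|ncE] := boolP (all (cross_edge k) E); last first.
  have W0 w : W w = 0 by rewrite /W walk_weight_checkerboard (negbTE ncE).
  have -> : (fun w => (W w)%:E) = cst 0%E by apply/funext => w; rewrite W0.
  split; first exact: integrable0.
  by rewrite integral0 lee_fin mulr_ge0 // exprn_ge0.
(* Repeated edges are collected into powers, so that the factors depend on distinct independent
   entries. *)
have WE w : W w = \prod_(e <- J) a N e.1 e.2 w ^+ count_mem e E.
  by rewrite /W walk_weight_checkerboard cE prodr_undup_exp_count.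
(* A cross edge is not a loop, since its endpoints lie in different residue classes. *)
have DJ e : e \in J -> D N e.
  rewrite mem_undup => eE; have := walk_edges_lt eE; rewrite /D /= => /andP [e12 ->].
  rewrite andbT ltn_neqAle e12 andbT; apply/eqP => e12'.
  by have := allP cE _ eE; rewrite /cross_edge e12' eqxx.
have uJ : uniq J by exact: undup_uniq.
pose f e (x : R) := x ^+ count_mem e E.
have mf e : measurable_fun setT (f e) by exact: measurable_funX.
have intf e : e \in J -> P.-integrable setT (fun w => (f e (a N e.1 e.2 w))%:E).
  move=> eJ; apply: le_integrable (int_a (DJ e eJ) (count_mem e E)) => //.
    by apply/measurable_EFinP; apply: measurableT_comp => //; apply: mX; exact: DJ.
  by move=> w _; rewrite /= lee_fin /f !normrX normr_id.
have -> : (fun w => (W w)%:E) = (fun w => (\prod_(e <- J) f e (a N e.1 e.2 w))%:E).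
  by apply/funext => w; rewrite WE.
have intW := integrable_prod_indep (mX (N := N)) (ind_N (N := N)) uJ DJ (fun e _ => mf e) intf.
split => //.
have [/allP e2|/allPn [e eE e1]] := boolP (all (fun e => 1 < count_mem e E)%N E); last first.
  have c1 : count_mem e E = 1%N.
    by apply/eqP; rewrite eqn_leq leqNgt e1 -has_count has_pred1.
  have eJ : e \in J by rewrite mem_undup.
  have pJ := perm_to_rem eJ.
  have eq0 : (\int[P]_w (a N e.1 e.2 w * \prod_(j <- rem e J ++ [::]) f j (a N j.1 j.2 w))%:E = 0)%E.
    have eJr : perm_eq (e :: rem e J ++ [::]) J by rewrite cats0 perm_sym.
    have rJ x : x \in rem e J ++ [::] -> x \in J by rewrite cats0; exact: mem_rem.
    apply: (integral_prod_indep_centered (X := fun e => a N e.1 e.2)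
      (mX (N := N)) (ind_N (N := N)) (e := e)) => //.
    - by rewrite (perm_uniq eJr).
    - by move=> x; rewrite (perm_mem eJr); exact: DJ.
    - by move=> x /rJ; exact: intf.
    - have := intf e eJ; rewrite /f c1.
      by under eq_fun do rewrite expr1.
    - exact: a_mean (DJ e eJ).
  rewrite (_ : (\int[P]_w _)%E = 0%E) ?lee_fin ?mulr_ge0 ?exprn_ge0 //.
  rewrite -[RHS]eq0; apply: eq_integral => w _; congr EFin.
  by rewrite (perm_big _ pJ) big_cons cats0 {1}/f c1 expr1.
have good : (size (undup (i :: p)) <= m.+1)%N by exact: size_undup_walk_double.
rewrite good mulr1.
apply: le_trans (_ : _ <= \int[P]_w (\prod_(e <- J) `|a N e.1 e.2 w| ^+ count_mem e E)%:E)%E _.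
  apply: le_trans (lee_abs _) _.
  apply: le_trans (le_abse_integral _ measurableT _) _; first exact: measurable_int intW.
  rewrite le_eqVlt; apply/orP; left; apply/eqP/eq_integral => w _.
  by rewrite abse_EFin normr_prod; congr EFin; apply: eq_bigr => e _; rewrite normrX.
rewrite (integral_prod_indep (X := fun e => a N e.1 e.2) (f := fun e x => `|x| ^+ count_mem e E)
   (c := fun e => abs_moment (count_mem e E)) (mX (N := N)) (ind_N (N := N))) //; last first.
  by move=> e eJ; apply: integral_abs_moment; exact: DJ.
(* Each multiplicity and the number of distinct edges are at most [2m], the length of the walk. *)
rewrite lee_fin; apply: (@le_trans _ _ (\prod_(e <- J) moment_bound m.*2)).
  rewrite big_seq [leRHS]big_seq; apply: ler_prod => e eJ; rewrite abs_moment_ge0 /=.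
  apply: abs_moment_le_bound; rewrite -sp -(size_walk_edges i p); exact: count_size.
rewrite big_const_seq count_predT iter_mulr mulr1 ler_weXn2l ?moment_bound_ge1 //.
by rewrite -sp -(size_walk_edges i p) size_undup.
Qed.

(** In the sum over closed walks, those with more than [m + 1] vertices contribute at most 0; the
    others are counted as words of length [2m + 1] with at most [m + 1] letters. *)
Lemma trace_moment N m :
  let Y w := \tr (checkerboard k [::] N (fun i j => a N i j w) ^+ m.*2) in
  P.-integrable setT (fun w => (Y w)%:E) /\
  (\int[P]_w (Y w)%:E <=
   (moment_bound m.*2 ^+ m.*2 * (m.+1 ^ (m.*2).+1)%:R * N%:R ^+ m.+1)%:E)%E.
Proof.
move=> Y; set K := moment_bound m.*2 ^+ m.*2.
have K0 : 0 <= K by apply: exprn_ge0; apply: le_trans (moment_bound_ge1 _).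
pose M w := checkerboard k [::] N (fun i j => a N i j w).
pose S (i : 'I_N) := [seq p <- words m.*2 (enum 'I_N) | last i p == i].
have sS i p : p \in S i -> size p = m.*2.
  by rewrite mem_filter mem_words => /andP [_ /andP [/eqP]].
have YE : (fun w => (Y w)%:E) =
    (fun w => \sum_(i < N) \sum_(p <- S i | p \in S i) (walk_weight (M w) i p)%:E)%E.
  apply/funext => w; rewrite /Y trace_expmx_walks -sumEFin; apply: eq_bigr => i _.
  by rewrite -big_filter -/(S i) big_seq sumEFin.
have intS i : P.-integrable setT
    (fun w => \sum_(p <- S i | p \in S i) (walk_weight (M w) i p)%:E)%E.
  apply: integrable_sum => // p pS.
  by have [] := walk_weight_moment i (sS _ _ pS).
split; first by rewrite YE; apply: integrable_sum.
rewrite YE integral_sum //.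
apply: (@le_trans _ _ (\sum_(i < N) \sum_(p <- S i | p \in S i)
    (K * (size (undup (i :: p)) <= m.+1)%N%:R)%:E)%E).
  apply: lee_sum => i _.
  have -> : (\int[P]_w \sum_(p <- S i | p \in S i) (walk_weight (M w) i p)%:E =
     \int[P]_w \sum_(p <- S i) if p \in S i then (walk_weight (M w) i p)%:E else 0)%E.
    by apply: eq_integral => w _; rewrite big_mkcond.
  rewrite integral_sum //.
    rewrite [leRHS]big_mkcond; apply: lee_sum => p _; case: ifP => pS; last by rewrite integral0.
    by have [] := walk_weight_moment i (sS _ _ pS).
  move=> p; have [pS|pS] := boolP (p \in S i); last exact: integrable0.
  by have [] := walk_weight_moment i (sS _ _ pS).
under eq_bigr do rewrite sumEFin -mulr_sumr.
rewrite sumEFin -mulr_sumr lee_fin -mulrA ler_wpM2l // mulrC.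
under eq_bigr do rewrite -big_seq -natr_sum.
rewrite -natr_sum -natrX -natrM ler_nat.
apply: leq_trans (count_closed_walks N m.*2 m.+1); apply: leq_sum => i _.
rewrite big_filter big_mkcond -sum1_count [leqRHS]big_mkcond.
by apply: leq_sum => p _; case: ifP => //; case: ifP.
Qed.

End Moments.

(** * Almost sure bounds from summable means *)

Lemma sum_inv_square_le2 (R : realFieldType) (n : nat) :
  \sum_(i < n) (i%:R ^+ 2)^-1 <= 2 :> R.
Proof.
(* The induction needs this stronger, telescoping bound. Its base case has the indices 0 and 1, and
   index 0 contributes 0 because [0^-1 = 0]. *)
suff H : \sum_(i < n.+2) (i%:R ^+ 2)^-1 <= 2 - n.+1%:R^-1 :> R.
  apply: le_trans (_ : _ <= \sum_(i < n.+2) (i%:R ^+ 2)^-1) _.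
    by rewrite !big_ord_recr /= -addrA lerDl addr_ge0.
  by apply: le_trans H _; rewrite gerBl.
elim: n => [|n IHn].
  rewrite !big_ord_recr big_ord0 /= expr0n expr1n invr0 invr1 !add0r.
  lra.
rewrite big_ord_recr /=; apply: le_trans (lerD IHn (lexx _)) _.
have x0 : 0 < n.+1%:R :> R by rewrite ltr0n.
rewrite -[n.+2%:R]natr1; move: (n.+1%:R) x0 => x x0.
rewrite -subr_ge0.
have -> : 2 - (x + 1)^-1 - (2 - x^-1 + ((x + 1) ^+ 2)^-1) = (x * (x + 1) ^+ 2)^-1.
  by field; rewrite !gt_eqF // ?addr_gt0.
by rewrite invr_ge0 mulr_ge0 ?exprn_ge0 ?ltW // addr_gt0.
Qed.

Lemma trace_even_ge0 (R : rcfType) (N m : nat) (A : 'M[R]_N) :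
  A^T = A -> 0 <= \tr (A ^+ m.*2).
Proof.
move=> /symmetric_spectral [U [d AU]]; rewrite (spectral_pair_exp_trace _ AU).
by apply: sumr_ge0 => i _; rewrite -mul2n exprM exprn_ge0 // sqr_ge0.
Qed.

Lemma powR_root_exp (R : realType) (x : R) (l : nat) :
  (0 < l)%N -> 0 <= x -> (x `^ l%:R^-1) ^+ l = x.
Proof.
move=> l0 x0; rewrite -powR_mulrn ?powR_ge0 // -powRrM mulVf ?powRr1 //.
by rewrite pnatr_eq0 -lt0n.
Qed.

(** The series of the [Y N] has integral at most [C], so it is almost everywhere finite, and its sum
    bounds each of its nonnegative terms. *)
Lemma ae_bounded_of_summable_integrals (d : measure_display) (T : measurableType d)
    (R : realType) (P : probability T R) (Y : nat -> T -> R) (c : nat -> R) (C : R) :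
  (forall N w, 0 <= Y N w) ->
  (forall N, P.-integrable setT (fun w => (Y N w)%:E)) ->
  (forall N, (\int[P]_w (Y N w)%:E <= (c N)%:E)%E) ->
  (forall n, \sum_(N < n) c N <= C) ->
  {ae P, forall w, exists s : R, 0 <= s /\ forall N, Y N w <= s}.
Proof.
move=> Y0 intY Yc cC.
have mY N : measurable_fun setT (fun w => (Y N w)%:E) by exact: measurable_int (intY N).
pose S w := (\sum_(N <oo) (Y N w)%:E)%E.
have S0 w : (0 <= S w)%E by apply: nneseries_ge0 => N _ _; rewrite lee_fin.
have mS : measurable_fun setT S by apply: ge0_emeasurable_sum => N *; rewrite ?lee_fin.
have intS : P.-integrable setT S.
  apply/integrableP; split => //.
  under eq_integral do rewrite gee0_abs //.
  rewrite integral_nneseries //; last by move=> N w _; rewrite lee_fin.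
  apply: le_lt_trans (ltry C); apply: lime_le.
    by apply: is_cvg_nneseries => N _ _; apply: integral_ge0 => w _; rewrite lee_fin.
  apply: nearW => n; rewrite big_mkord.
  apply: le_trans (_ : _ <= \sum_(N < n) (c N)%:E)%E _; first exact: lee_sum.
  by rewrite sumEFin lee_fin.
have := integrable_ae measurableT intS; apply: filterS => w /(_ I) Sfin.
exists (fine (S w)); split; first exact: fine_ge0.
move=> N; rewrite -lee_fin fineK //.
apply: le_trans (nneseries_lim_ge N.+1 _); last by move=> n _ _; rewrite lee_fin.
rewrite big_mkord big_ord_recr /= leeDr //.
by apply: sume_ge0 => n _; rewrite lee_fin.
Qed.

Theorem mainTheorem1 (d : measure_display) (T : measurableType d)
  (R : realType) (P : probability T R)
  (k : nat) (W : seq R)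
  (a : nat -> nat -> nat -> T -> R) :
  (0 < k)%N -> size W = k ->
  (* the entries a N i j, 0 <= i < j < N, of all the matrices A_N *)
  (forall N i j, (i < j < N)%N -> measurable_fun setT (a N i j)) ->
  (* are identically distributed, *)
  (forall N i j N' i' j', (i < j < N)%N -> (i' < j' < N')%N ->
     same_distribution P (a N i j) (a N' i' j')) ->
  (* jointly independent (i.i.d. within A_N, and the A_N independent in N), *)
  mutually_independent P [set t | (t.1.2 < t.2 < t.1.1)%N]
    (fun t : nat * nat * nat => a t.1.1 t.1.2 t.2) ->
  (* with finite moments of all orders, mean 0 and variance 1 *)
  (forall N i j, (i < j < N)%N -> forall p : nat,
     P.-integrable setT (fun w => (`|a N i j w| ^+ p)%:E)) ->
  (forall N i j, (i < j < N)%N -> (\int[P]_w (a N i j w)%:E = 0)%E) ->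
  (forall N i j, (i < j < N)%N -> (\int[P]_w ((a N i j w) ^+ 2)%:E = 1)%E) ->
  forall eps : R, 0 < eps ->
  {ae P, forall w, exists C : R, exists N0 : nat, forall N : nat, (N0 <= N)%N ->
     exists s : seq R, exists lab : seq (option R),
       eigenvalue_list (checkerboard k W N (fun i j => a N i j w)) s /\
       size lab = N /\
       (* N - x eigenvalues are O(N^(1/2+eps)) *)
       count (fun q => q.2 == None) (zip s lab) = (N - count (fun x : R => x != 0%R) W)%N /\
       (* for each nonzero value v of W, exactly (multiplicity of v in W)
          eigenvalues are N v / k + O(N^(1/2+eps)) *)
       (forall v : R, v != 0 ->
          count (fun q => q.2 == Some v) (zip s lab) = count_mem v W) /\
       all (fun q => match q.2 with
                     | None => `|q.1| <= C * (N%:R `^ (2^-1 + eps))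
                     | Some v => `|q.1 - N%:R * v / k%:R| <= C * (N%:R `^ (2^-1 + eps))
                     end) (zip s lab)}.
Proof.
move=> k0 sW ma id_a ind_a int_a a_mean _ eps eps0.
(* Makes [m * eps] exceed 3, which gives [(m + 3) / (2m) <= 1/2 + eps]. *)
pose m := Num.bound (3 / eps).
have lt_m : 3 / eps < m%:R by apply: archi_boundP; rewrite divr_ge0 // ltW.
have m0R : 0 < m%:R :> R by apply: le_lt_trans lt_m; rewrite divr_ge0 // ltW.
have m0 : (0 < m)%N by rewrite ltr0n in m0R.
pose M N w := checkerboard k [::] N (fun i j => a N i j w).
(* The mean of the trace is at most of order [N ^ (m + 1)]; dividing by two more powers of [N] makes
   the means summable. *)
pose Y N w := \tr (M N w ^+ m.*2) / N%:R ^+ (m + 3).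
pose K := moment_bound P a m.*2 ^+ m.*2 * (m.+1 ^ (m.*2).+1)%:R.
have K0 : 0 <= K.
  by rewrite mulr_ge0 // exprn_ge0 // (le_trans _ (moment_bound_ge1 _ _ _)).
have tr0 N w : 0 <= \tr (M N w ^+ m.*2) by apply: trace_even_ge0; exact: checkerboard_sym.
have YE N : (fun w => (Y N w)%:E) =
    (fun w => ((N%:R ^+ (m + 3))^-1)%:E * (\tr (M N w ^+ m.*2))%:E)%E.
  by apply/funext => w; rewrite -EFinM mulrC.
have trM N := trace_moment k ma id_a ind_a int_a a_mean N m.
have Yc N : (\int[P]_w (Y N w)%:E <= (K * (N%:R ^+ 2)^-1)%:E)%E.
  have [intM leM] := trM N.
  rewrite YE integralZl //.
  apply: le_trans (lee_wpmul2l _ leM) _; first by rewrite lee_fin invr_ge0 exprn_ge0.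
  rewrite -EFinM lee_fin -/K mulrCA ler_wpM2l //.
  (* At [N = 0] the left side vanishes by the convention [0^-1 = 0]. *)
  have [->|N0] := eqVneq N 0%N; first by rewrite !expr0n addnC /= invr0 mul0r.
  have N0R : N%:R != 0 :> R by rewrite pnatr_eq0.
  have -> : (m + 3 = m.+1 + 2)%N by lia.
  by rewrite exprD invfM mulrC mulrA mulfV ?mul1r // expf_neq0.
have H1 N w : 0 <= Y N w by rewrite divr_ge0 // exprn_ge0.
have H2 N : P.-integrable setT (fun w => (Y N w)%:E).
  by rewrite YE; apply: integrableZl => //; have [] := trM N.
have H3 n : \sum_(N < n) K * (N%:R ^+ 2)^-1 <= K * 2.
  by rewrite -mulr_sumr ler_wpM2l // sum_inv_square_le2.
have := ae_bounded_of_summable_integrals H1 H2 Yc H3; apply: filterS => w [s [s0 sY]].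
set V := \sum_(x <- W) `|x|.
have V0 : 0 <= V by apply: sumr_ge0.
(* The first summand is the constant of the norm bound [rho], the second absorbs the class-size
   error [V]. Taking [N >= k] allows [checkerboard_regimes] and gives [1 <= N]. *)
exists (s `^ (m.*2)%:R^-1 + V), k => N kN.
have N1 : 1 <= N%:R :> R by rewrite ler1n; exact: leq_trans k0 kN.
have Ngt0 : 0 < N%:R :> R by apply: lt_le_trans N1.
pose x := s * N%:R ^+ (m + 3).
have x0 : 0 <= x by rewrite mulr_ge0 // exprn_ge0 // ltW.
have m20 : (0 < m.*2)%N by rewrite double_gt0.
pose rho := x `^ (m.*2)%:R^-1.
have trx : \tr (M N w ^+ m.*2) <= rho ^+ m.*2.
  rewrite /rho powR_root_exp // /x -ler_pdivrMr ?exprn_gt0 //.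
  exact: sY.
have [t [lab [eigt [szlab [cN [cS /allP bnd]]]]]] :=
  checkerboard_regimes k0 sW (a := fun i j => a N i j w) kN m0 (powR_ge0 _ _) trx.
exists t, lab; do 4 split => //.
have le_bound : rho + V <= (s `^ (m.*2)%:R^-1 + V) * N%:R `^ (2^-1 + eps).
  rewrite mulrDl; apply: lerD; last first.
    rewrite ler_peMr // -[leLHS](powRr0 N%:R) ler_powR // addr_ge0 ?invr_ge0 //.
    exact: ltW.
  have NX0 : 0 <= N%:R ^+ (m + 3) :> R by rewrite exprn_ge0 // ltW.
  rewrite /rho /x powRM //; apply: ler_wpM2l; first exact: powR_ge0.
  rewrite -(powR_mulrn _ (ltW Ngt0)).
  rewrite -powRrM ler_powR // natrD -mul2n natrM.
  (* Over the common denominator [2m], the exponents compare as [m + 3 <= m + 2 m eps]. *)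
  rewrite -[leRHS]mulr1 -[X in _ <= _ * X](@mulfV _ (2 * m%:R)) ?gt_eqF ?mulr_gt0 //.
  rewrite mulrA ler_wpM2r ?invr_ge0 ?mulr_ge0 ?ltW //.
  rewrite ltr_pdivrMr // in lt_m.
  have -> : (2^-1 + eps) * (2 * m%:R) = m%:R + 2 * (m%:R * eps) :> R by field.
  by move: (m%:R * eps) lt_m => y lt_m; lra.
by apply/allP => q /bnd; case: q.2 => [v|] /le_trans; apply.
Qed.
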